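(* Let $Q$ be a symmetric real $n\times n$ matrix, $v\in\mathbb{R}^n$ a column vector, and $f(\bar{x})=\frac12\bar{x}^TQ\bar{x}+v^T\bar{x}$ for $\bar x\in\mathbb{R}^n$. Let $b_1,\dots,b_n$, $a_1,\dots,a_p$ and $g_1,\dots,g_n$ be real numbers, and let the binarization map, sending a binary array $y=(y_{ij})_{1\le i\le p,\,1\le j\le n}$, $y_{ij}\in\{0,1\}$, to $\bar{x}=(x_1,\dots,x_n)^T$, have the form $$x_j=b_j\sum_{i=1}^{p}a_iy_{ij}+g_j,\qquad j=1,\ldots,n.$$ Let $D_b$ be the $n\times n$ diagonal matrix with entries $b_j$ on the diagonal, let $a$ be the row vector $(a_1,\dots,a_p)$, and let $g=(g_1,\dots,g_n)^T$. Then $$\bar{x}=(D_b\otimes a)\bar{y}+g,$$ and the change of variables in the objective function is given by $$f(\bar{x})=\frac{1}{2}\bar{y}^T\big(D_bQD_b\otimes a^Ta\big)\bar{y}+\big(D_b(Qg+v)\otimes a^T\big)^T\bar{y}+f(g).$$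
   Context: $\bar{y}$ denotes the column vector of length $pn$ obtained from the array $y=(y_{ij})_{1\le i\le p,\,1\le j\le n}$ by Fortran-style (column-major) ordering, so that $y_{ij}$ is the entry of $\bar y$ in position $p(j-1)+i$. For an $m\times n$ matrix $A$ and a $p\times q$ matrix $B$, the Kronecker product $A\otimes B$ is the $mp\times nq$ block matrix whose $(i,j)$ block is $a_{ij}B$; that is, the element $a_{ij}b_{kl}$ is in row $p(i-1)+k$ and column $q(j-1)+l$. Row and column vectors are treated as matrices with one row or one column. *)

(* Defs.v *)
From mathcomp Require Import all_boot all_order all_algebra.
From mathcomp.real_closed Require Export mxtens.
From mathcomp Require Export reals.

Set Implicit Arguments.
Unset Strict Implicit.
Unset Printing Implicit Defensive.

Import GRing.Theory.
Local Open Scope ring_scope.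

(* The Kronecker product is [tensmx], written [A *t B]: its rows and columns
   are indexed through [mxtens_index (i, k) = i * p + k], with 0-based [i < m]
   and [k < p], i.e. [A i j * B k l] sits in (1-based) row [p(i-1)+k] and column
   [q(j-1)+l]; see [tensmxE]. *)

(* Column-major vectorization, so that [y i j] is in the 0-based position
   [p * j + i].  The library's [mxvec] is row-major and yields a row vector. *)
Definition colvec (R : Type) (p n : nat) (y : 'M[R]_(p, n)) : 'cV[R]_(n * p) :=
  \col_k y (mxtens_unindex k).2 (mxtens_unindex k).1.

(* [M 0 0] reads a 1 x 1 matrix as a scalar. *)
Definition quadfun (R : realType) (n : nat) (Q : 'M[R]_n) (v x : 'cV[R]_n) : R :=
  2^-1 * (x^T *m Q *m x) 0 0 + (v^T *m x) 0 0.

(* Main.v *)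
Require Import Defs.
From mathcomp Require Import all_boot all_order all_algebra.
From mathcomp.real_closed Require Import mxtens.
From mathcomp Require Import reals.
From mathcomp Require Import ring.

Set Implicit Arguments.
Unset Strict Implicit.
Unset Printing Implicit Defensive.

Import GRing.Theory.
Local Open Scope ring_scope.

(** Column-major vectorization turns a Kronecker product into a two-sided
    matrix product: [(A *t B) *m colvec y = colvec (B *m y *m A^T)]
    ([tensmx_mul_colvec]).  With [u := (a *m y *m D)^T], whose [j]-th entry is
    [b_j] times the sum of the [a_i y_ij], this identifies [(D *t a) *m ybar]
    with [u], so that [x = u + g].

    Expanding [f (u + g)] around [g] ([quadfunD]) leaves a quadratic and a linear
    form in [u].  The quadratic form in [ybar] is, through the trace formula for
    the dot product of vectorized matrices ([colvec_dot]), the trace of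
    [y^T a^T a y D Q D]; moving factors cyclically gives the 1 x 1 matrix
    [a y D Q D y^T a^T = u^T Q u].  The transposed linear coefficient is again a
    Kronecker product, [(D (Q g + v))^T *t a], so the same vectorization identity
    rewrites the linear term as [a y D (Q g + v) = u^T (Q g + v)]. *)

Lemma sum_mxtens_index (V : nmodType) (m n : nat) (F : 'I_(m * n) -> V) :
  \sum_k F k = \sum_(i < m) \sum_(j < n) F (mxtens_index (i, j)).
Proof.
rewrite pair_bigA (reindex (@mxtens_index m n)) /=; last first.
  by exists (@mxtens_unindex m n) => ? _;
    rewrite ?mxtens_indexK ?mxtens_unindexK.
by apply: eq_bigr => -[].
Qed.

(** The vec identity: summing [A i j * B l h * y h j] over the pair [(j, h)]
    that indexes the columns of the Kronecker product is the double sum that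
    defines the [(l, i)] entry of [B *m y *m A^T]. *)
Lemma tensmx_mul_colvec (R : comPzRingType) (m n p q : nat)
    (A : 'M[R]_(m, n)) (B : 'M[R]_(q, p)) (y : 'M[R]_(p, n)) :
  (A *t B) *m colvec y = colvec (B *m y *m A^T).
Proof.
apply/colP => k; case: (mxtens_indexP k) => i l.
rewrite mxE sum_mxtens_index !mxE mxtens_indexK.
apply: eq_bigr => j _; rewrite !mxE mulr_suml.
apply: eq_bigr => h _; rewrite tensmxE mxE mxtens_indexK.
by rewrite -mulrA mulrC.
Qed.

(** Both sides sum the products of corresponding entries, column by column. *)
Lemma colvec_dot (R : pzRingType) (p n : nat) (y z : 'M[R]_(p, n)) :
  ((colvec y)^T *m colvec z) 0 0 = \tr (y^T *m z).
Proof.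
rewrite mxE sum_mxtens_index; apply: eq_bigr => j _.
by rewrite mxE; apply: eq_bigr => h _; rewrite !mxE mxtens_indexK.
Qed.

Lemma castmx_colvec_row (R : Type) (n : nat) (r : 'rV[R]_n) :
  castmx (muln1 n, erefl 1) (colvec r) = r^T.
Proof.
apply/colP => j; rewrite castmxE !mxE !ord1.
by congr (r _ _); apply: val_inj; rewrite /= divn1.
Qed.

(** Symmetry of [Q] makes the two cross terms [u^T Q g] and [g^T Q u] equal, and
    the factor 1/2 absorbs their sum into the gradient [Q g + v] of the quadratic
    function at [g]. *)
Lemma quadfunD (R : realType) (n : nat) (Q : 'M[R]_n) (v u g : 'cV[R]_n) :
  Q^T = Q ->
  quadfun Q v (u + g) =
  2^-1 * (u^T *m Q *m u) 0 0 + (u^T *m (Q *m g + v)) 0 0 + quadfun Q v g.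
Proof.
move=> hQ.
have tr11 (A : 'M[R]_1) : A^T = A by rewrite [A]mx11_scalar tr_scalar_mx.
have sym : g^T *m Q *m u = u^T *m Q *m g.
  by rewrite -[LHS]tr11 !trmx_mul trmxK hQ mulmxA.
have lin : v^T *m u = u^T *m v by rewrite -[LHS]tr11 trmx_mul trmxK.
rewrite /quadfun [(u + g)^T]raddfD /= !mulmxDl !mulmxDr sym lin !mulmxA.
have addE (A B : 'M[R]_1) : (A + B) 0 0 = A 0 0 + B 0 0 by rewrite mxE.
by rewrite !addE; field.
Qed.

Theorem mainTheorem3 (R : realType) (n p : nat)
    (Q : 'M[R]_n) (v : 'cV[R]_n)
    (b : 'rV[R]_n) (a : 'rV[R]_p) (g : 'cV[R]_n)
    (y : 'M[R]_(p, n)) (x : 'cV[R]_n)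
    (hQ : Q^T = Q)
    (hy : forall i j, y i j = 0 \/ y i j = 1)
    (hx : forall j, x j 0 = b 0 j * (\sum_(i < p) a 0 i * y i j) + g j 0) :
  let D := diag_mx b in
  let f := quadfun Q v in
  let ybar := colvec y in
  x = castmx (muln1 n, erefl (n * p)%N) (D *t a) *m ybar + g
  /\
  f x = 2^-1 * (ybar^T *m ((D *m Q *m D) *t (a^T *m a)) *m ybar) 0 0
        + ((((D *m (Q *m g + v)) *t a^T : 'cV[R]_(n * p))^T) *m ybar) 0 0
        + f g.
Proof.
move=> D f ybar.
have DT : D^T = D by rewrite tr_diag_mx.
pose u : 'cV[R]_n := (a *m y *m D)^T.
have Ku : castmx (muln1 n, erefl (n * p)%N) (D *t a) *m ybar = u.
  rewrite -[RHS]castmx_colvec_row -{2}DT -tensmx_mul_colvec.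
  by apply/colP => j; rewrite castmxE !mxE; apply: eq_bigr => k _;
    rewrite castmxE /= !cast_ord_id.
have xE : x = u + g.
  by apply/colP => j; rewrite hx /u /D mul_mx_diag !mxE mulrC.
split; first by rewrite Ku.
rewrite xE /f quadfunD //; congr (_ * _ + _ + _).
- (* Both sides become traces; two cyclic moves bring [y^T], then [a^T], from
     the far left of the product to its far right. *)
  rewrite -[X in _ = fun_of_matrix X _ _]mulmxA tensmx_mul_colvec colvec_dot.
  rewrite /u !trmx_mul !trmxK hQ DT.
  rewrite -trace_mx11 [RHS]mxtrace_mulC -!mulmxA.
  by rewrite [RHS]mxtrace_mulC !mulmxA.
- set c := Q *m g + v.
  (* The row dimension of [_^T *t a] is [1 * 1], which is [1] by conversion but
     not syntactically, so the lemmas are instantiated by hand. *)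
  have -> : ((D *m c) *t a^T : 'cV[R]_(n * p))^T = (D *m c)^T *t a.
    by have := trmx_tens (D *m c) a^T; rewrite trmxK => <-.
  rewrite /ybar (tensmx_mul_colvec (D *m c)^T a y).
  rewrite [RHS]mxE /u !trmxK mulmxA.
  (* The indices left are the quotient and remainder of 0 by 1. *)
  by congr (fun_of_matrix _ _ _); apply: val_inj; rewrite /= ?div0n ?mod0n.
Qed.
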